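(* For every Noetherian space $X$, $\mathrm{sob}(X^\circledast) \leq (||X|| \otimes \omega) + 1$, or equivalently, $\mathrm{rsob}(X^\circledast) \leq ||X|| \otimes \omega$.
   Context: A topological space is Noetherian if every open subset is compact (every open cover has a finite subcover; no separation is required). For a well-founded poset $P$ and $x \in P$, $\mathrm{rk}_P(x) = \sup_{x' < x} (\mathrm{rk}_P(x')+1)$ and the ordinal rank of $P$ is $|P| = \sup_{x \in P} (\mathrm{rk}_P(x)+1)$, where $\sup\emptyset = 0$. $\mathcal{H}_0 X$ is the poset of all closed subsets of $X$ (including $\emptyset$), ordered by inclusion; it is well-founded when $X$ is Noetherian. The stature of a Noetherian space $X$ is $||X|| = |\mathcal{H}_0 X| - 1$, equivalently $||X|| = \mathrm{rk}_{\mathcal{H}_0 X}(X)$. A closed subset $C$ of $X$ is irreducible if it is non-empty and, whenever $C \subseteq F_1 \cup F_2$ with $F_1, F_2$ closed in $X$, we have $C \subseteq F_1$ or $C \subseteq F_2$. $\mathcal{S} X$ is the poset of irreducible closed subsets of $X$, ordered by inclusion. The sobrification rank of a Noetherian space $X$ is $\mathrm{sob}\, X = |\mathcal{S} X|$. When $X$ is non-empty, $\mathrm{sob}\, X$ is a successor ordinal and the reduced sobrification rank $\mathrm{rsob}\, X$ is $\mathrm{sob}\, X - 1$ (the ordinal whose successor is $\mathrm{sob}\, X$). $X^*$ is the set of finite words over $X$ with the word topology: the topology generated by the subsets $X^* U_1 X^* U_2 X^* \cdots X^* U_n X^*$ (concatenation of sets of words), where $n \in \mathbb{N}$ and $U_1,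 \ldots, U_n$ are open subsets of $X$. $X^\circledast$ is the set of finite multisets over $X$, i.e. maps $m \colon X \to \mathbb{N}$ with $m(x) = 0$ for all but finitely many $x$, with the quotient topology induced by the Parikh mapping $\Psi \colon X^* \to X^\circledast$, which maps a word $w$ to the multiset counting the number of occurrences of each $x \in X$ in $w$. $X^\circledast$ is Noetherian when $X$ is. $\otimes$ is the natural (Hessenberg) product of ordinals. *)

(* Defs.v *)
From HB Require Import structures.
From mathcomp Require Import all_boot all_order all_algebra.
From mathcomp Require Import finmap multiset generic_quotient.
From mathcomp Require Import all_classical all_reals all_analysis.

Set Implicit Arguments.
Unset Strict Implicit.
Unset Printing Implicit Defensive.

Local Open Scope classical_set_scope.

(* Ordinals are represented by well-founded trees: [olim f] denotes the least *)
(* ordinal strictly above all the [f i].  Distinct trees may denote the same  *)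
(* ordinal: equality of ordinals is [oeq], not [=].                           *)
Inductive Ord : Type := olim (I : Type) (f : I -> Ord).

Definition odom (a : Ord) : Type := let: @olim K _ := a in K.
Definition osub (a : Ord) : odom a -> Ord :=
  match a with @olim K f => f end.
Arguments osub : clear implicits.

Fixpoint ole (a b : Ord) : Prop :=
  let: @olim K f := a in forall i : K, exists j : odom b, ole (f i) (osub b j).
Definition olt (a b : Ord) : Prop := exists j : odom b, ole a (osub b j).
Definition oeq (a b : Ord) : Prop := ole a b /\ ole b a.

Definition ozero : Ord := olim (of_void Ord).
Definition osucc (a : Ord) : Ord := olim (fun _ : unit => a).
Definition osup (I : Type) (f : I -> Ord) : Ord :=
  olim (fun p : {i : I & odom (f i)} => osub (f (projT1 p)) (projT2 p)).
(* [opred (osucc a)] is [a]; zero and limit ordinals are left unchanged. *)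
Definition opred (a : Ord) : Ord := osup (osub a).
Definition onat (n : nat) : Ord := iter n osucc ozero.
Definition oomega : Ord := olim onat.

(* a + b is the least ordinal above all ordinals below a and all a + b', b' < b *)
Fixpoint oadd (a b : Ord) : Ord :=
  let: @olim J g := b in
  olim (fun x : odom a + J =>
    match x with inl i => osub a i | inr j => oadd a (g j) end).

(* a * b is the supremum of the a * b' + a, b' < b *)
Fixpoint omul (a b : Ord) : Ord :=
  let: @olim J g := b in osup (fun j => oadd (omul a (g j)) a).

(* omega ^ a is the maximum of 1 and of the supremum of the                   *)
(* omega ^ a' * omega, a' < a                                                 *)
Fixpoint opow (a : Ord) : Ord :=
  let: @olim K f := a in
  osup (fun o : option K =>
    match o with None => onat 1 | Some i => omul (opow (f i)) oomega end).

Fixpoint nonincreasing (s : seq Ord) : Prop :=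
  match s with
  | x :: ((y :: _) as s') => ole y x /\ nonincreasing s'
  | _ => True
  end.
(* Insertion sort, in nonincreasing order.  The library's [sort] and [sorted] *)
(* are avoided: they would constrain the universe of [Ord] to lie below that  *)
(* of topological spaces, whose ranks [Ord] must contain.                     *)
Fixpoint oinsert (x : Ord) (s : seq Ord) : seq Ord :=
  match s with
  | [::] => [:: x]
  | y :: s' => if `[< ole y x >] then x :: s else y :: oinsert x s'
  end.
Definition osort (s : seq Ord) : seq Ord := foldr oinsert [::] s.

Definition ocnf (s : seq Ord) : Ord :=
  foldr (fun e r => oadd (opow e) r) ozero s.
(* s is the list of exponents of a Cantor normal form of a *)
Definition is_cnf (a : Ord) (s : seq Ord) : Prop :=
  nonincreasing s /\ oeq a (ocnf s).

Lemma ole_refl a : ole a a.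
Proof. elim: a => I f IH i; exists i; exact: IH. Qed.

Lemma ole_trans a b c : ole a b -> ole b c -> ole a c.
Proof.
elim: a b c => I f IH [J g] [K h] /= ab bc i.
have [j aj] := ab i; have [k bk] := bc j; exists k; exact: IH aj bk.
Qed.

Lemma olt_sub a i : olt (osub a i) a.
Proof. by exists i; exact: ole_refl. Qed.

Lemma oleP a b : ole a b <-> forall c, olt c a -> olt c b.
Proof.
case: a => I f; split => [ab c [i ci]|ab i].
  by have [j fj] := ab i; exists j; exact: ole_trans ci fj.
exact: (ab (f i) (@olt_sub (olim f) i)).
Qed.

Lemma olt_ole_trans a b c : olt a b -> ole b c -> olt a c.
Proof. by move=> ab /oleP; apply. Qed.

Lemma ole_olt_trans a b c : ole a b -> olt b c -> olt a c.
Proof. by move=> ab [k bk]; exists k; exact: ole_trans _ bk. Qed.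

Lemma oltW a b : olt a b -> ole a b.
Proof.
elim: a b => I f IH b [j aj] i; exists j; apply: IH.
exact: olt_ole_trans (@olt_sub (olim f) i) aj.
Qed.

Lemma olt_wf : well_founded olt.
Proof.
suff H a c : ole c a -> Acc olt c by move=> a; apply: H (ole_refl a).
elim: a c => I f IH c ca; constructor => d dc.
by have [i di] := olt_ole_trans dc ca; exact: IH di.
Qed.

Lemma olt_irr a : ~ olt a a.
Proof. by elim/(well_founded_ind olt_wf): a => a IH aa; exact: (IH a). Qed.

Lemma onle_lt a b : ~ ole a b -> olt b a.
Proof.
elim: a b => I f IHa b /existsNP [i fi].
exists i; apply: contrapT => nbi; apply: fi.
move: nbi; case: b => J g /existsNP [j gj]; exists j.
apply: contrapT => nfg; apply: gj.
by have := IHa i (g j) nfg.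
Qed.

Lemma ole_osup I (f : I -> Ord) i : ole (f i) (osup f).
Proof.
apply/oleP => c [j cj]; exists (existT (fun i => odom (f i)) i j); exact: cj.
Qed.

Lemma osup_ole I (f : I -> Ord) b :
  (forall i, ole (f i) b) -> ole (osup f) b.
Proof.
by move=> fb [i j]; exact: olt_ole_trans (olt_sub j) (fb i).
Qed.

Lemma olt_osup I (f : I -> Ord) b : olt b (osup f) -> exists i, olt b (f i).
Proof. by move=> [[i j] bj]; exists i, j. Qed.

Lemma oleDl a b : ole a (oadd a b).
Proof. by case: b => J g; apply/oleP => c [i ci]; exists (inl i). Qed.

Arguments oleDl : clear implicits.

Lemma olt_oaddP a b c :
  olt c (oadd a b) <-> olt c a \/ exists2 d, olt d b & ole c (oadd a d).
Proof.
elim: b c => J g IH c /=; split.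
  move=> [[i|j] /= cj]; first by left; exists i.
  by right; exists (g j) => //; exists j; exact: ole_refl.
move=> [[i ci]|[d [j dj] cd]]; first by exists (inl i).
exists (inr j) => /=; apply/oleP => e /olt_ole_trans /(_ cd).
case: d dj cd => K h dj _ [[i|k] /= ek].
  by apply/IH; left; exists i.
apply/IH; right; exists (h k); last exact: ek.
exact: olt_ole_trans (@olt_sub (olim h) k) dj.
Qed.

Lemma ole_oadd a a' b b' : ole a a' -> ole b b' -> ole (oadd a b) (oadd a' b').
Proof.
elim/(well_founded_ind olt_wf): b b' => b IH b' aa' bb'.
apply/oleP => c /olt_oaddP [ca|[d db cd]]; apply/olt_oaddP.
  by left; exact: olt_ole_trans _ aa'.
right; exists d; first exact: olt_ole_trans _ bb'.
by apply: ole_trans cd _; apply: IH => //; exact: ole_refl.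
Qed.

Lemma olt_oadd a b b' : olt b b' -> olt (oadd a b) (oadd a b').
Proof. by move=> bb'; apply/olt_oaddP; right; exists b => //; exact: ole_refl. Qed.

Lemma oleDr a b : ole b (oadd a b).
Proof.
elim/(well_founded_ind olt_wf): b => b IH.
apply/oleP => c cb; apply: (@ole_olt_trans _ (oadd a c)); first exact: IH.
exact: olt_oadd.
Qed.

Lemma oaddA a b c : oeq (oadd a (oadd b c)) (oadd (oadd a b) c).
Proof.
elim/(well_founded_ind olt_wf): c => c IH; split; apply/oleP => x.
  move=> /olt_oaddP [xa|[d /olt_oaddP [db|[e ec de]] xd]].
  - by apply/olt_oaddP; left; exact: olt_ole_trans _ (oleDl _ _).
  - apply/olt_oaddP; left; apply/olt_oaddP; right; exists d => //.
  - apply/olt_oaddP; right; exists e => //.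
    apply: ole_trans xd _; apply: ole_trans _ (proj1 (IH e ec)).
    exact: ole_oadd (ole_refl _) de.
move=> /olt_oaddP [/olt_oaddP [xa|[d db xd]]|[e ec xe]]; apply/olt_oaddP.
- by left.
- by right; exists d => //; exact: olt_ole_trans _ (oleDl _ _).
- right; exists (oadd b e); first exact: olt_oadd.
  exact: ole_trans xe (proj2 (IH e ec)).
Qed.

Lemma omin (P : Ord -> Prop) :
  (exists a, P a) -> exists2 a, P a & forall b, olt b a -> ~ P b.
Proof.
move=> [a Pa]; apply: contrapT => /forall2NP H; move: a Pa.
elim/(well_founded_ind olt_wf) => a IH Pa.
by case: (H a) => // /existsNP [b] /not_implyP [ba] /contrapT; exact: IH.
Qed.

Lemma oadd0 d : ole (oadd ozero d) d.
Proof.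
elim/(well_founded_ind olt_wf): d => d IH.
apply/oleP => x /olt_oaddP [[[]]|[d' dd xd]].
exact: ole_olt_trans (ole_trans xd (IH _ dd)) dd.
Qed.

Lemma oadd_subK a c : ole a c -> exists r, oeq c (oadd a r).
Proof.
move=> ac; have [|r cr rmin] := @omin (fun r => ole c (oadd a r)).
  by exists c; exact: oleDr.
exists r; split => //; apply/oleP => x /olt_oaddP [/olt_ole_trans|]; first exact.
move=> [d dr xd]; apply: ole_olt_trans xd _; apply: onle_lt; exact: rmin.
Qed.

Lemma ole_omulS a n :
  ole (oadd (omul a (onat n)) a) (omul a (onat n.+1)).
Proof. exact: (ole_osup (fun _ : unit => oadd (omul a (onat n)) a) tt). Qed.

Lemma omulS_ole a n :
  ole (omul a (onat n.+1)) (oadd (omul a (onat n)) a).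
Proof.
exact: (@osup_ole _ (fun _ : unit => oadd (omul a (onat n)) a) _
  (fun=> ole_refl _)).
Qed.

Arguments ole_omulS : clear implicits.
Arguments omulS_ole : clear implicits.

Lemma ge1_opow a : ole (onat 1) (opow a).
Proof.
case: a => K f.
exact: (ole_osup (fun o : option K =>
  match o with None => onat 1 | Some i => omul (opow (f i)) oomega end) None).
Qed.

Lemma omul_opow_ole K (f : K -> Ord) i :
  ole (omul (opow (f i)) oomega) (opow (olim f)).
Proof.
exact: (ole_osup (fun o : option K => match o with
  None => onat 1 | Some i => omul (opow (f i)) oomega end) (Some i)).
Qed.

Arguments omul_opow_ole : clear implicits.
Arguments omul_opow_ole {K}.

Lemma olt_opowP K (f : K -> Ord) b : olt b (opow (olim f)) ->
  ole b ozero \/ exists i, olt b (omul (opow (f i)) oomega).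
Proof.
move=> /(@olt_osup _ (fun o : option K => match o with
  None => onat 1 | Some i => omul (opow (f i)) oomega end)) [[i|] bi].
  by right; exists i.
by left; case: bi.
Qed.

Lemma ole_omul_omega a n : ole (oadd (omul a (onat n)) a) (omul a oomega).
Proof. exact: (ole_osup (fun n => oadd (omul a (onat n)) a) n). Qed.

Arguments ole_omul_omega : clear implicits.

Lemma olt_omul_omega a b : olt b (omul a oomega) ->
  exists n, olt b (oadd (omul a (onat n)) a).
Proof. exact: (@olt_osup _ (fun n => oadd (omul a (onat n)) a)). Qed.

Lemma olt0pow a : olt ozero (opow a).
Proof. by apply: olt_ole_trans _ (ge1_opow a); exists tt; exact: ole_refl. Qed.

Lemma ole_opow a b : ole a b -> ole (opow a) (opow b).
Proof.
elim: a b => K f IH [J g] ab; apply/oleP => c /olt_opowP [c0|[i]].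
  exact: ole_olt_trans c0 (olt0pow _).
move=> /olt_omul_omega [n /olt_ole_trans]; apply.
have [j fg] := ab i.
apply: ole_trans _ (omul_opow_ole g j); apply: ole_trans _ (ole_omul_omega _ n).
suff mono m : ole (omul (opow (f i)) (onat m)) (omul (opow (g j)) (onat m)).
  by apply: ole_oadd; [exact: mono|exact: IH].
elim: m => [|m IHm]; first by move=> -[[]].
apply: ole_trans (omulS_ole _ _) _; apply: ole_trans _ (ole_omulS _ _).
by apply: ole_oadd => //; exact: IH.
Qed.

Lemma olt_opowS a : olt (opow a) (opow (osucc a)).
Proof.
apply: olt_ole_trans _ (omul_opow_ole (fun _ : unit => a) tt).
apply: olt_ole_trans _ (ole_omul_omega _ 1).
apply: ole_olt_trans (oleDl _ ozero) _.
apply: olt_ole_trans (olt_oadd _ (olt0pow a)) _.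
apply: ole_oadd; last exact: ole_refl.
by apply: ole_trans _ (ole_omulS _ 0); exact: oleDr.
Qed.

Lemma ole_pow a : ole a (opow a).
Proof.
elim/(well_founded_ind olt_wf): a => a IH; apply/oleP => b ba.
apply: ole_olt_trans (IH _ ba) _; apply: olt_ole_trans (olt_opowS b) _.
by apply: ole_opow; case: b ba {IH} => I f ba [].
Qed.

Lemma oadd_omulS a m :
  oeq (oadd a (omul a (onat m))) (omul a (onat m.+1)).
Proof.
elim: m => [|m [IH1 IH2]]; split.
- apply: (ole_trans _ (ole_omulS a 0)); apply: (ole_trans _ (oleDr _ _)).
  by apply/oleP => x /olt_oaddP [//|[d [[[]]]]].
- apply: ole_trans (omulS_ole a 0) _.
  have a0 : ole (omul a (onat 0)) ozero by move=> [[]].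
  apply: ole_trans (ole_oadd a0 (ole_refl a)) _.
  exact: ole_trans (oadd0 a) (oleDl a _).
- apply: (ole_trans _ (ole_omulS a m.+1)).
  apply: (ole_trans _ (ole_oadd IH1 (ole_refl a))).
  apply: (ole_trans _ (proj1 (oaddA _ _ _))).
  exact: ole_oadd (ole_refl a) (omulS_ole a m).
- apply: ole_trans (omulS_ole a m.+1) _.
  apply: ole_trans (ole_oadd IH2 (ole_refl a)) _.
  apply: ole_trans (proj2 (oaddA _ _ _)) _.
  exact: ole_oadd (ole_refl a) (ole_omulS a m).
Qed.

Lemma ocnf_cat n e s :
  oeq (ocnf (nseq n e ++ s)) (oadd (omul (opow e) (onat n)) (ocnf s)).
Proof.
elim: n => [|n [IH1 IH2]].
  split; first exact: oleDr.
  apply: (ole_trans _ (oadd0 _)); apply: ole_oadd; last exact: ole_refl.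
  by move=> [[]].
have [c1 c2] := oadd_omulS (opow e) n; split.
  apply: ole_trans (ole_oadd (ole_refl _) IH1) _.
  apply: ole_trans (proj1 (oaddA _ _ _)) _.
  exact: ole_oadd c1 (ole_refl _).
apply: (ole_trans _ (ole_oadd (ole_refl _) IH2)).
apply: (ole_trans _ (proj2 (oaddA _ _ _))).
exact: ole_oadd c2 (ole_refl _).
Qed.

Lemma cnf_exists a : exists s, is_cnf a s.
Proof.
elim/(well_founded_ind olt_wf): a => a IH.
have [a0|/onle_lt a0] := pselect (ole a ozero).
  by exists [::]; split => //; split => //; move=> [].
have [|e ae emin] := @omin (fun e => olt a (opow (osucc e))).
  by exists a; exact: ole_olt_trans (ole_pow a) (olt_opowS a).
have ea : ole (opow e) a.
  case: e ae emin => K f _ emin; apply/oleP => b /olt_opowP [b0|[i bi]].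
    exact: ole_olt_trans b0 a0.
  apply: olt_ole_trans bi _; apply: contrapT => /onle_lt af.
  apply: (emin (f i)); first exact: (@olt_sub (olim f)).
  exact: olt_ole_trans af (omul_opow_ole (fun _ : unit => f i) tt).
have [n an] : exists n, olt a (omul (opow e) (onat n)).
  have [a0'|[_ /olt_omul_omega [n an]]] := olt_opowP ae.
    by case: (olt_irr (olt_ole_trans a0 a0')).
  by exists n.+1; exact: olt_ole_trans an (ole_omulS _ n).
have [m [am ma]] : exists m, olt a (omul (opow e) (onat m.+1)) /\
    ole (omul (opow e) (onat m)) a.
  elim: n an => [|n IHn] an; first by case: an => -[[]].
  have [/IHn//|na] := pselect (olt a (omul (opow e) (onat n))).
  exists n; split=> //; apply: contrapT => /onle_lt; exact: na.
have [r [ar ra]] := oadd_subK ma.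
have re : olt r (opow e).
  apply: contrapT => nre; apply: (@olt_irr a).
  apply: olt_ole_trans am _; apply: ole_trans _ ra.
  apply: ole_trans (omulS_ole _ _) _; apply: ole_oadd (ole_refl _) _.
  by apply: contrapT => /onle_lt.
have [s [ss [rs sr]]] := IH _ (olt_ole_trans re ea).
exists (nseq m e ++ s); split; last first.
  have [c1 c2] := ocnf_cat m e s; split.
    by apply: ole_trans _ c2; apply: ole_trans ar _; exact: ole_oadd (ole_refl _) rs.
  by apply: ole_trans c1 _; apply: ole_trans _ ra; exact: ole_oadd (ole_refl _) sr.
case: m {am ma ar ra} => [//|m] /=; elim: m => [|m IHm] /=; last first.
  by split; [exact: ole_refl|exact: IHm].
case: s ss rs sr => [//|x s] ss _ sr; split=> //.
apply: contrapT => /onle_lt ex; apply: (@olt_irr r).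
apply: olt_ole_trans re _; apply: ole_trans (ole_opow (oltW ex)) _.
exact: ole_trans (oleDl _ _) sr.
Qed.

Definition cnf (a : Ord) : seq Ord := proj1_sig (cid (cnf_exists a)).

(* Hessenberg sum and product: if a = omega ^ a_1 + ... + omega ^ a_m and     *)
(* b = omega ^ b_1 + ... + omega ^ b_n in Cantor normal form, the exponents   *)
(* of the natural sum are the a_i and the b_j, and those of the natural       *)
(* product are the natural sums of a_i and b_j, for all pairs (i, j).         *)
Definition nadd (a b : Ord) : Ord := ocnf (osort (cnf a ++ cnf b)).
Definition nmul (a b : Ord) : Ord :=
  ocnf (osort [seq nadd x y | x <- cnf a, y <- cnf b]).

(* When R is well-founded, every element is accessible and [orank R] is the   *)
(* ordinal rank of R.                                                         *)
Fixpoint acc_rank (T : Type) (R : T -> T -> Prop) (x : T) (ax : Acc R x)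
    {struct ax} : Ord :=
  olim (fun y : {y : T | R y x} => acc_rank (Acc_inv ax (proj2_sig y))).
Definition orank (T : Type) (R : T -> T -> Prop) : Ord :=
  olim (fun x : {x : T | Acc R x} => acc_rank (proj2_sig x)).

Definition noetherian (X : topologicalType) : Prop :=
  forall U : set X, open U -> cover_compact U.

Definition irreducible_closed (X : topologicalType) (C : set X) : Prop :=
  [/\ closed C, C !=set0 &
      forall F1 F2 : set X, closed F1 -> closed F2 ->
        C `<=` F1 `|` F2 -> C `<=` F1 \/ C `<=` F2].

Definition subset_rank (T : Type) (P : set T -> Prop) : Ord :=
  orank (fun A B : {A : set T | P A} => proj1_sig A `<` proj1_sig B).

Definition stature (X : topologicalType) : Ord :=
  opred (subset_rank (@closed X)).
Definition sob (X : topologicalType) : Ord :=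
  subset_rank (@irreducible_closed X).
Definition rsob (X : topologicalType) : Ord := opred (sob X).

Definition words (X : topologicalType) : Type := seq X.

Definition catset (T : Type) (A B : set (seq T)) : set (seq T) :=
  [set w | exists u v, [/\ A u, B v & w = u ++ v]].
Definition letters (T : Type) (U : set T) : set (seq T) :=
  [set w | exists2 x, U x & w = [:: x]].
(* X^* U_1 X^* U_2 X^* ... X^* U_n X^* *)
Definition word_subbasic (T : Type) (Us : seq (set T)) : set (seq T) :=
  foldr (fun U W => catset setT (catset (letters U) W)) setT Us.

HB.instance Definition _ (X : topologicalType) := Choice.on (words X).
HB.instance Definition _ (X : topologicalType) :=
  @isSubBaseTopological.Build (words X) (set (seq X))
    [set W | exists2 Us : seq (set X),
       (forall U, U \in Us -> open U) & W = word_subbasic Us]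
    id.

Definition mset_carrier (X : topologicalType) : Type := multiset X.
Definition parikh (X : topologicalType) : words X -> mset_carrier X := @seq_mset X.

Lemma parikhK (X : topologicalType) :
  cancel (fun m : mset_carrier X => enum_mset m : words X) (@parikh X).
Proof. move=> m; exact: seq_mset_id. Qed.

HB.instance Definition _ (X : topologicalType) :=
  @isQuotient.Build (words X) (mset_carrier X) _ (@parikh X) (@parikhK X).

Definition msets (X : topologicalType) : topologicalType :=
  quotient_topology (mset_carrier X).

Lemma msets_openE (X : topologicalType) (U : set (msets X)) :
  open U = open ((@parikh X : words X -> msets X) @^-1` U).
Proof.
have -> : open U = open ((\pi_(msets X) : words X -> msets X) @^-1` U)%qT by [].
suff -> : (\pi_(msets X) : words X -> msets X)%qT = @parikh X by [].
by apply/funext => w; rewrite unlock.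
Qed.

(* Main.v *)
Require Import Defs.
From mathcomp Require Import all_boot all_classical all_analysis.
From mathcomp Require Import finmap multiset.

Set Implicit Arguments.
Unset Strict Implicit.
Unset Printing Implicit Defensive.
Local Open Scope classical_set_scope.

(** A finite multiset on [X] belongs to the product F | C_1, ..., C_n, where F
    and the C_i are closed, if all its elements are in F except for at most
    one element of each C_i.  A product gets as weight the ordinal

      (rk F ⊗ ω) ⊕ (rk (F ∪ C_1) - rk F) ⊕ ... ⊕ (rk (F ∪ C_n) - rk F)

    where rk is the rank among the closed sets of [X], which exists because
    closed sets satisfy the descending chain condition, and - is left
    subtraction.  The product with F = X and no C_i is the whole space of
    multisets, and its weight is at most ||X|| ⊗ ω, so it is enough to bound
    the rank of an irreducible closed set D by the weight of every product P
    that contains D.  By induction on D ([acc_rank_weight]), this follows from a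
    shrinking lemma ([irreducible_shrink]): if D is contained in P and misses
    a point m of P, then D is contained in a product of smaller weight.

    To shrink P, choose open sets V(x), one for each element x of m, such
    that D contains no multiset obtained by replacing each x by an element
    of V(x) and then adding elements.  A multiset m' of P that does not arise
    in this way lies in one of finitely many smaller products
    ([mprod_shrink]).  Either m' fails to meet V(x) in the slot C_i that x
    occupies in m, and C_i can be replaced by C_i \ V(x).  Or m' meets these
    conditions, but a greedy search for elements of the sets V(x), for the
    remaining x, gets stuck after k successes; then all elements outside the
    slots, apart from k of them, avoid some V(x), and F can be replaced by
    F \ V(x) at the cost of k additional slots F.  An irreducible set covered
    by finitely many closed sets is contained in one of them.

    Shrinking a slot decreases one summand of the weight.  Shrinking the base
    F to F' may add many slots, and increases each of the subtracted ranks by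
    at most c = rk F - rk F' > 0; what makes the weight decrease is the
    inequality (a ⊗ ω) ⊕ c ⊕ ... ⊕ c <= (a + c) ⊗ ω, for any finite
    number of summands c ([htimes_omega_add]).  It is proved by comparing
    Cantor normal forms, since a power of omega is closed under natural sums
    ([opow_hclosed]). *)

(** * Elementary facts on ordinals *)

Lemma ole0 a : ole ozero a.
Proof. by case. Qed.

Lemma ole_osucc a b : ole a b -> ole (osucc a) (osucc b).
Proof. by move=> ab u; exists tt. Qed.

Lemma osucc_ole a b : olt a b -> ole (osucc a) b.
Proof. by move=> ab _. Qed.

Lemma ole_total a b : ole a b \/ olt b a.
Proof. by have [|/onle_lt] := pselect (ole a b); [left|right]. Qed.

Lemma oadd_cancel a b c : ole (oadd a b) (oadd a c) -> ole b c.
Proof.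
move=> abc; have [//|cb] := ole_total b c.
by case: (olt_irr (ole_olt_trans abc (olt_oadd a cb))).
Qed.

Lemma oadd_lt_cancel a b c : olt (oadd a b) (oadd a c) -> olt b c.
Proof.
move=> abc; have [cb|//] := ole_total c b.
by case: (olt_irr (olt_ole_trans abc (ole_oadd (ole_refl a) cb))).
Qed.

(** * Natural sum *)

(** The natural sum as the least operation that is strictly monotone in both
    arguments.  Compared with [nadd], whose definition sorts Cantor normal
    forms, the algebraic laws are immediate; the two are related by
    [hsum_nadd]. *)
Fixpoint hsum (a : Ord) : Ord -> Ord :=
  match a with
  | @olim K f =>
    fix hsum_a (b : Ord) : Ord :=
      match b with
      | @olim J g => olim (fun x : K + J =>
          match x with inl i => hsum (f i) b | inr j => hsum_a (g j) end)
      end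
  end.

Lemma ole_hsum a a' b b' : ole a a' -> ole b b' -> ole (hsum a b) (hsum a' b').
Proof.
elim: a a' b b' => I f IHf [I' f'] b b' aa'.
elim: b b' => J g IHg [J' g'] bb' [i|j].
  by have [i' ii'] := aa' i; exists (inl i');
    exact: (IHf i _ (olim g) (olim g')).
by have [j' jj'] := bb' j; exists (inr j'); exact: (IHg j (g' j')).
Qed.

Lemma hsumC a b : ole (hsum a b) (hsum b a).
Proof.
elim: a b => I f IHf; elim=> J g IHg [i|j].
  by exists (inr i); exact: (IHf i (olim g)).
by exists (inl j); exact: (IHg j).
Qed.

Lemma olt_hsuml a a' b : olt a a' -> olt (hsum a b) (hsum a' b).
Proof.
case: a' b => I f [J g] [i ai]; exists (inl i).
exact: ole_hsum (ole_refl _).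
Qed.

Lemma olt_hsumr a b b' : olt b b' -> olt (hsum a b) (hsum a b').
Proof.
move=> bb'; apply: ole_olt_trans (hsumC _ _) _.
exact: olt_ole_trans (olt_hsuml a bb') (hsumC _ _).
Qed.

Lemma hsum_ole a b c :
  (forall a', olt a' a -> olt (hsum a' b) c) ->
  (forall b', olt b' b -> olt (hsum a b') c) -> ole (hsum a b) c.
Proof.
case: a b => I f [J g] ac bc [i|j].
  exact/ac/(@olt_sub (olim f)).
exact/bc/(@olt_sub (olim g)).
Qed.

Lemma hsumAl a b c : ole (hsum (hsum a b) c) (hsum a (hsum b c)).
Proof.
elim: a b c => I f IHf; elim=> J g IHg; elim=> K h IHh [[i|j]|k].
- by exists (inl i); exact: (IHf i (olim g) (olim h)).
- by exists (inr (inl j)); exact: (IHg j (olim h)).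
- by exists (inr (inr k)); exact: IHh.
Qed.

Lemma hsumAr a b c : ole (hsum a (hsum b c)) (hsum (hsum a b) c).
Proof.
apply: ole_trans (hsumC _ _) _.
apply: ole_trans (ole_hsum (hsumC _ _) (ole_refl _)) _.
apply: ole_trans (hsumAl _ _ _) _; apply: ole_trans (hsumC _ _) _.
exact: ole_hsum (hsumC _ _) (ole_refl _).
Qed.

Lemma hsumCA a b c : ole (hsum a (hsum b c)) (hsum b (hsum a c)).
Proof.
apply: ole_trans (hsumAr _ _ _) _.
apply: ole_trans (ole_hsum (hsumC _ _) (ole_refl _)) _; exact: hsumAl.
Qed.

Lemma ole_hsuml a b : ole a (hsum a b).
Proof.
by elim: a b => I f IH [J g] i; exists (inl i); exact: IH.
Qed.

Lemma ole_hsumr a b : ole b (hsum a b).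
Proof. exact: ole_trans (ole_hsuml b a) (hsumC _ _). Qed.

Lemma hsum0 a : ole (hsum a ozero) a.
Proof. by elim: a => I f IH [i|[]]; exists i; exact: IH. Qed.

Lemma oadd_hsum a b : ole (oadd a b) (hsum a b).
Proof.
case: a => I f; elim: b => J g IH [i|j]; last by exists (inr j); exact: IH.
by exists (inl i); exact: ole_hsuml.
Qed.

(** * Powers of omega are closed under natural sums *)

(** Additive indecomposability, for the natural sum. *)
Definition hclosed (a : Ord) : Prop :=
  forall x y, olt x a -> olt y a -> olt (hsum x y) a.

Lemma odiv_nat a u n : olt u (omul a (onat n)) ->
  exists k x, [/\ (k < n)%N, olt x a & oeq u (oadd (omul a (onat k)) x)].
Proof.
elim: n => [|n IH] un; first by case: un => -[[]].
have [nu|/IH [k [x [kn xa ux]]]] := ole_total (omul a (onat n)) u; last first.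
  by exists k, x; split=> //; exact: ltnW.
have [x ux] := oadd_subK nu; exists n, x; split=> //.
apply: (@oadd_lt_cancel (omul a (onat n))).
apply: ole_olt_trans (proj2 ux) _.
exact: olt_ole_trans un (omulS_ole _ _).
Qed.

Lemma ole_omul_nat a m n : (m <= n)%N ->
  ole (omul a (onat m)) (omul a (onat n)).
Proof.
elim: n => [|n IH]; first by rewrite leqn0 => /eqP ->; exact: ole_refl.
rewrite leq_eqVlt => /orP[/eqP ->|mn]; first exact: ole_refl.
apply: ole_trans (IH mn) _; apply: ole_trans (oleDl _ _) (ole_omulS _ _).
Qed.

(** Below [omul a oomega], where a is closed under natural sums, the natural
    sum adds quotients and remainders of divisions by a.  The statement is an
    inequality for arbitrary u and v, so that the induction can lower either
    of them without computing a normal form. *)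
Lemma hsum_omul_nat a m n x y u v : hclosed a -> olt x a -> olt y a ->
  ole u (oadd (omul a (onat m)) x) -> ole v (oadd (omul a (onat n)) y) ->
  ole (hsum u v) (oadd (omul a (onat (m + n))) (hsum x y)).
Proof.
move=> acl.
(* decreasing one argument decreases its quotient or its remainder *)
have step k z w : olt z a -> olt w (oadd (omul a (onat k)) z) ->
    exists k' z', [/\ olt z' a, ole w (oadd (omul a (onat k')) z') &
      forall l t, olt t a -> olt (oadd (omul a (onat (k' + l))) (hsum z' t))
                                 (oadd (omul a (onat (k + l))) (hsum z t))].
  move=> za /olt_oaddP [/odiv_nat [k' [z' [k'k z'a [wz' _]]]]|[z' z'z wz']].
    exists k', z'; split=> // l t ta.
    apply: olt_ole_trans (olt_oadd _ (acl _ _ z'a ta)) _.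
    apply: ole_trans (ole_omulS _ _) _; apply: ole_trans (oleDl _ _).
    by apply: ole_omul_nat; rewrite -addSn leq_add2r.
  exists k, z'; split=> // [|l t ta]; last exact/olt_oadd/olt_hsuml.
  exact: olt_ole_trans z'z (oltW za).
elim/(well_founded_ind olt_wf): u v m n x y => u IHu v.
elim/(well_founded_ind olt_wf): v => v IHv m n x y xa ya um vn.
apply: hsum_ole => [u' u'u|v' v'v].
  have [m' [x' [x'a u'm lt]]] := step _ _ _ xa (olt_ole_trans u'u um).
  exact: ole_olt_trans (IHu _ u'u _ _ _ _ _ x'a ya u'm vn) (lt _ _ ya).
have [n' [y' [y'a v'n lt]]] := step _ _ _ ya (olt_ole_trans v'v vn).
apply: ole_olt_trans (IHv _ v'v _ _ _ _ xa y'a um v'n) _.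
apply: (@olt_ole_trans _ (oadd (omul a (onat (n + m))) (hsum y x))).
  rewrite addnC; apply: ole_olt_trans (lt _ _ xa).
  by apply: ole_oadd (hsumC _ _); exact: ole_refl.
by rewrite addnC; apply: ole_oadd (hsumC _ _); exact: ole_refl.
Qed.

Lemma ole_opowS e n : ole (omul (opow e) (onat n)) (opow (osucc e)).
Proof.
apply: ole_trans (omul_opow_ole (fun _ : unit => e) tt).
exact: ole_trans (oleDl _ _) (ole_omul_omega _ n).
Qed.

Lemma olt_opowSP e u : olt u (opow (osucc e)) ->
  exists n x, olt x (opow e) /\ oeq u (oadd (omul (opow e) (onat n)) x).
Proof.
move=> /olt_opowP [u0|[_ /olt_omul_omega [n un]]].
  exists 0%N, ozero; split; first exact: olt0pow.
  split; first exact: ole_trans u0 (ole0 _).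
  by move=> [[[]]|[]].
have [k [x [_ xe ux]]] := odiv_nat (olt_ole_trans un (ole_omulS _ n)).
by exists k, x.
Qed.

(** By induction on the exponent: if c = [opow e] is closed, two ordinals below
    [opow (osucc e)] are bounded by finite multiples of c plus remainders,
    which [hsum_omul_nat] adds up; and two ordinals below a limit power are
    both below one successor power. *)
Lemma opow_hclosed e : hclosed (opow e).
Proof.
have succ c : hclosed (opow c) -> hclosed (opow (osucc c)).
  move=> ccl x y /olt_opowSP [m [x' [x'c [xm _]]]].
  move=> /olt_opowSP [n [y' [y'c [yn _]]]].
  apply: ole_olt_trans (hsum_omul_nat ccl x'c y'c xm yn) _.
  apply: olt_ole_trans (olt_oadd _ (ccl _ _ x'c y'c)) _.
  exact: ole_trans (ole_omulS _ _) (ole_opowS _ _).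
elim: e => I f IH x y xe ye.
have below z : olt z (opow (olim f)) ->
    ole z ozero \/ exists i, olt z (opow (osucc (f i))).
  move=> /olt_opowP [|[i zi]]; [by left|right; exists i].
  exact: olt_ole_trans zi (omul_opow_ole (fun _ : unit => f i) tt).
have [x0|[i xi]] := below _ xe.
  apply: ole_olt_trans ye; apply: ole_trans (hsumC _ _) _.
  exact: ole_trans (ole_hsum (ole_refl _) x0) (hsum0 _).
have [y0|[j yj]] := below _ ye.
  apply: ole_olt_trans xe.
  exact: ole_trans (ole_hsum (ole_refl _) y0) (hsum0 _).
have [k [xk yk]] : exists k,
    olt x (opow (osucc (f k))) /\ olt y (opow (osucc (f k))).
  have [ij|/oltW ji] := ole_total (f i) (f j).
    by exists j; split=> //; apply: olt_ole_trans xi (ole_opow (ole_osucc ij)).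
  by exists i; split=> //; apply: olt_ole_trans yj (ole_opow (ole_osucc ji)).
apply: olt_ole_trans (succ _ (IH k) _ _ xk yk) _.
by apply: ole_opow; apply: osucc_ole; exact: (@olt_sub (olim f)).
Qed.

(** An ordinal below [opow (osucc e)] has no exponent larger than e, hence
    adding [opow e] on the left absorbs nothing. *)
Lemma hsum_opow e r : olt r (opow (osucc e)) ->
  ole (hsum (opow e) r) (oadd (opow e) r).
Proof.
move=> /olt_opowSP [n [x [xe [rn nr]]]].
have e1 : ole (opow e) (oadd (omul (opow e) (onat 1)) ozero).
  apply: ole_trans (oleDl _ _); apply: ole_trans (ole_omulS _ 0).
  exact: oleDr.
apply: ole_trans (hsum_omul_nat (@opow_hclosed e) (olt0pow e) xe e1 rn) _.
have x0 : ole (hsum ozero x) x by apply: ole_trans (hsumC _ _) (hsum0 _).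
rewrite add1n; apply: ole_trans (ole_oadd (proj2 (oadd_omulS _ n)) x0) _.
apply: ole_trans (proj2 (oaddA _ _ _)) _.
exact: ole_oadd (ole_refl _) nr.
Qed.

(** * Natural sums of powers of omega and Cantor normal forms *)

(** Unlike [ocnf], this sum does not depend on the order of the exponents; the
    two agree on nonincreasing lists ([ocnf_hpows], [hpows_ocnf]). *)
Definition hpows (s : seq Ord) : Ord :=
  foldr (fun e r => hsum (opow e) r) ozero s.

Lemma nonincreasing_behead x s : nonincreasing (x :: s) -> nonincreasing s.
Proof. by case: s => //= y s []. Qed.

Lemma hpows_lt x s : nonincreasing (x :: s) ->
  olt (hpows (x :: s)) (opow (osucc x)).
Proof.
elim: s x => [|y s IH] x xs; apply: (@opow_hclosed (osucc x));
  try exact: olt_opowS.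
  exact: olt0pow.
have [yx ys] := xs.
exact: olt_ole_trans (IH _ ys) (ole_opow (ole_osucc yx)).
Qed.

Lemma ocnf_hpows s : ole (ocnf s) (hpows s).
Proof.
elim: s => [|x s IH]; first exact: ole_refl.
exact: ole_trans (oadd_hsum _ _) (ole_hsum (ole_refl _) IH).
Qed.

Lemma ocnf_lt x s : nonincreasing (x :: s) ->
  olt (ocnf (x :: s)) (opow (osucc x)).
Proof. by move=> xs; exact: ole_olt_trans (ocnf_hpows _) (hpows_lt xs). Qed.

Lemma hpows_ocnf s : nonincreasing s -> ole (hpows s) (ocnf s).
Proof.
elim: s => [|x s IH] xs; first exact: ole_refl.
have sx : olt (ocnf s) (opow (osucc x)).
  by apply: ole_olt_trans (ocnf_lt xs); exact: oleDr.
apply: ole_trans (hsum_opow sx).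
exact: ole_hsum (ole_refl _) (IH (nonincreasing_behead xs)).
Qed.

Lemma nonincreasing_osort s : nonincreasing (osort s).
Proof.
elim: s => //= x s; elim: (osort s) => [|y t IH] //= yt.
case: asboolP => [yx|nyx] //.
have xy : ole x y by exact/oltW/onle_lt.
have := IH (nonincreasing_behead yt).
case: t yt {IH} => [|z t] //= [zy zt].
by case: asboolP.
Qed.

Lemma hpows_osort s : ole (hpows s) (ocnf (osort s)).
Proof.
apply: ole_trans (hpows_ocnf (nonincreasing_osort s)).
elim: s => [|x s IH]; first exact: ole_refl.
change (ole (hsum (opow x) (hpows s)) (hpows (oinsert x (osort s)))).
apply: ole_trans (ole_hsum (ole_refl _) IH) _.
elim: (osort s) => [|y t IHt]; first exact: ole_refl.
rewrite [oinsert _ _]/=; case: asboolP => _; first exact: ole_refl.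
exact: ole_trans (hsumCA _ _ _) (ole_hsum (ole_refl _) IHt).
Qed.

Lemma hpows_cat s t : ole (hsum (hpows s) (hpows t)) (hpows (s ++ t)).
Proof.
elim: s => [|x s IH] /=; first exact: ole_trans (hsumC _ _) (hsum0 _).
exact: ole_trans (hsumAl _ _ _) (ole_hsum (ole_refl _) IH).
Qed.

Lemma cnfP a : is_cnf a (cnf a).
Proof. exact: proj2_sig (cid (cnf_exists a)). Qed.

Lemma hsum_nadd a b : ole (hsum a b) (nadd a b).
Proof.
have [_ [sa _]] := cnfP a; have [_ [tb _]] := cnfP b.
apply: ole_trans (hpows_osort _); apply: ole_trans (hpows_cat _ _).
apply: ole_hsum; first exact: ole_trans sa (ocnf_hpows _).
exact: ole_trans tb (ocnf_hpows _).
Qed.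

(** * The natural product by omega *)

(** The natural product by omega: every exponent e becomes the natural sum of
    e and 1, which is the successor of e. *)
Definition htimes_omega (a : Ord) : Ord := hpows (map osucc (cnf a)).

Definition hmuln (a : Ord) (n : nat) : Ord := iter n (hsum a) ozero.

Lemma hmuln_lt e a n : olt a (opow e) -> olt (hmuln a n) (opow e).
Proof.
by move=> ae; elim: n => [|n IH]; [exact: olt0pow|exact: opow_hclosed].
Qed.

Lemma hpows_osucc_lt x s : nonincreasing (x :: s) ->
  olt (hpows (map osucc (x :: s))) (opow (osucc (osucc x))).
Proof.
move=> xs; apply: (@hpows_lt (osucc x)).
elim: s x xs => [|y s IH] x //= [yx ys]; split; last exact: IH.
exact: ole_osucc.
Qed.

(** Equal leading exponents of s and u cancel.  At the first position where
    they differ, or where s ends, the exponent y of u exceeds the remaining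
    exponents of s, and c < [opow (osucc y)] because c is bounded by the sum
    of the remaining terms of u.  Then what remains of the left-hand side, n
    copies of c included, is a natural sum of ordinals below
    [opow (osucc y)], which is the leading term on the right. *)
Lemma hpows_osucc_add s u c n : nonincreasing s -> nonincreasing u ->
  ole (oadd (ocnf s) c) (ocnf u) ->
  ole (hsum (hpows (map osucc s)) (hmuln c n)) (hpows (map osucc u)).
Proof.
elim: s u => [|x s IH] u ss us scu.
  apply: ole_trans (hsumC _ _) _; apply: ole_trans (hsum0 _) _.
  have cu : ole c (ocnf u) by exact: ole_trans (oleDr _ _) scu.
  case: u us {scu} cu => [|y u] us cu.
    elim: n => [|n IHn]; first exact: ole_refl.
    by apply: ole_trans (ole_hsum cu IHn) (hsum0 _).
  apply: ole_trans (ole_hsuml _ _); apply/oltW/hmuln_lt.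
  exact: ole_olt_trans cu (ocnf_lt us).
have xu : ole (opow x) (ocnf u).
  by apply: ole_trans scu; apply: ole_trans (oleDl _ _) (oleDl _ _).
case: u us scu xu => [|y u] us scu xu.
  by case: (olt_irr (olt_ole_trans (olt0pow x) xu)).
have xy : ole x y.
  have [//|yx] := ole_total x y; case: (@olt_irr (opow x)).
  apply: ole_olt_trans xu _; apply: olt_ole_trans (ocnf_lt us) _.
  exact/ole_opow/osucc_ole.
have [yx|{}xy] := ole_total y x; last first.
  apply: ole_trans (ole_hsuml _ _); apply/oltW/opow_hclosed.
    apply: olt_ole_trans (hpows_osucc_lt ss) _.
    exact/ole_opow/ole_osucc/osucc_ole.
  apply: hmuln_lt; apply: ole_olt_trans (ocnf_lt us).
  exact: ole_trans (oleDr _ _) scu.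
apply: ole_trans (hsumAl _ _ _) _.
apply: ole_hsum; first exact/ole_opow/ole_osucc.
apply: IH; [exact: nonincreasing_behead ss|exact: nonincreasing_behead us|].
apply: (@oadd_cancel (opow x)).
apply: ole_trans (proj1 (oaddA _ _ _)) _; apply: ole_trans scu _.
exact: ole_oadd (ole_opow yx) (ole_refl _).
Qed.

Lemma htimes_omega_add a b c n : ole (oadd a c) b ->
  ole (hsum (htimes_omega a) (hmuln c n)) (htimes_omega b).
Proof.
have [sa [_ aE]] := cnfP a; have [sb [bE _]] := cnfP b => acb.
apply: hpows_osucc_add => //; apply: ole_trans bE; apply: ole_trans acb.
exact: ole_oadd aE (ole_refl _).
Qed.

(** Were the leading exponent of omega zero, omega would be a finite sum of
    ones. *)
Lemma cnf_omega : exists y s,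
  cnf oomega = y :: s /\ ole (osucc ozero) y.
Proof.
case: (cnf oomega) (cnfP oomega) => [|y s] [ss [os _]].
  by case: (os 0%N) => -[].
exists y, s; split=> //; apply: osucc_ole.
have [y0|//] := ole_total y ozero.
have pow0 : ole (opow y) (onat 1).
  apply: ole_trans (ole_opow y0) _; apply: osup_ole => -[[]|].
  exact: ole_refl.
have [n [x [x1 [on _]]]] := olt_opowSP (ole_olt_trans os (ocnf_lt ss)).
have {}x0 : ole x ozero.
  by have [//|/osucc_ole x0] := ole_total x ozero;
     case: (olt_irr (olt_ole_trans (olt_ole_trans x1 pow0) x0)).
suff fin k : ole (omul (opow y) (onat k)) (onat k).
  case: (@olt_irr (onat n)); apply: (@olt_ole_trans _ oomega).
    by exists n; exact: ole_refl.
  apply: ole_trans on _; apply: ole_trans (ole_oadd (fin n) x0) _.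
  by apply: ole_trans (oadd_hsum _ _) (hsum0 _).
elim: k => [|k IH]; first by move=> [[]].
apply: ole_trans (omulS_ole _ _) _; apply: ole_trans (ole_oadd IH pow0) _.
move=> [i|[]]; first by exists tt; exact: oltW (olt_sub i).
by exists tt; apply: ole_trans (oadd_hsum _ _) (hsum0 _).
Qed.

(** Some exponent y of omega is at least 1, and the pairs (x, y) alone already
    contribute natural sums that are at least the successor of x. *)
Lemma htimes_omega_nmul a : ole (htimes_omega a) (nmul a oomega).
Proof.
have [y [s [omegaE y1]]] := cnf_omega.
apply: ole_trans (hpows_osort _); rewrite /htimes_omega omegaE.
elim: (cnf a) => [|x r IH]; first exact: ole_refl.
apply: ole_trans (hpows_cat _ _); apply: ole_hsum => //.
apply: ole_trans (ole_hsuml _ _).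
apply: ole_opow; apply: ole_trans (hsum_nadd _ _).
apply: ole_trans (oadd_hsum _ _); apply: osucc_ole.
by apply/olt_oaddP; right; exists ozero; [exact: y1 tt|exact: oleDl].
Qed.

(** * Ranks *)

Lemma acc_rank_lt T (R : T -> T -> Prop) x y (ax : Acc R x) (ay : Acc R y) :
  R y x -> olt (acc_rank ay) (acc_rank ax).
Proof.
case: ax => ax yx; exists (exist _ y yx); rewrite /=.
by rewrite (Prop_irrelevance ay (ax y yx)); exact: ole_refl.
Qed.

Lemma acc_rank_ole T (R : T -> T -> Prop) x (ax : Acc R x) c :
  (forall y (ay : Acc R y), R y x -> olt (acc_rank ay) c) ->
  ole (acc_rank ax) c.
Proof. by case: ax => ax H [y yx]; exact: H. Qed.

Definition closed_lt (X : topologicalType) (A B : {A : set X | closed A}) :=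
  proj1_sig A `<` proj1_sig B.

(** Along a strictly decreasing sequence of closed sets, the union of the
    complements would be an open set without a finite subcover. *)
Lemma noetherian_Acc (X : topologicalType) (A : {A : set X | closed A}) :
  noetherian X -> Acc (@closed_lt X) A.
Proof.
move=> noeth; apply: contrapT => nA.
pose T := {B : {B : set X | closed B} | ~ Acc (@closed_lt X) B}.
have next (B : T) : {C : T | closed_lt (proj1_sig C) (proj1_sig B)}.
  case: B => B nB; apply: cid; apply: contrapT => nC; apply: (nB).
  constructor => C CB; apply: contrapT => nAC; apply: nC.
  by exists (exist _ C nAC).
have [f [f0 fS]] := dependent_choice next (exist _ A nA).
pose g n : set X := proj1_sig (proj1_sig (f n)).
have gS n : g n.+1 `<` g n by exact: fS.
have gle m n : (m <= n)%N -> g n `<=` g m.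
  elim: n => [|n IH]; first by rewrite leqn0 => /eqP ->.
  rewrite leq_eqVlt => /orP[/eqP ->//|/IH]; apply: subset_trans.
  by have [] := gS n.
have gcl n : closed (g n) by exact: (proj2_sig (proj1_sig (f n))).
pose U := \bigcup_n ~` g n.
have Uo : open U by apply: bigcup_open => n _; exact/closed_openC/gcl.
have [n _|//|D _ UD] := noeth U Uo nat setT (fun n => ~` g n).
  exact/closed_openC/gcl.
pose N := (\max_(i <- D) i)%N.
have [_] := gS N; apply => x gNx; apply: contrapT => ngx.
have [|i /= iD] := UD x; first by exists N.+1.
by apply; apply: gle gNx; exact: leq_bigmax_seq.
Qed.

Lemma subset_properl T (A B C : set T) : A `<` B -> B `<=` C -> A `<` C.
Proof.
move=> [AB nBA] BC; split=> [|CA]; first exact: subset_trans BC.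
exact/nBA/(subset_trans BC).
Qed.

(** The rank of C among closed sets, extended to all subsets of [X] so that it
    can be used without carrying proofs of closedness and accessibility. *)
Definition crank (X : topologicalType) (C : set X) : Ord :=
  olim (fun p : {q : {A : {A : set X | closed A} | Acc (@closed_lt X) A} |
                 proj1_sig (proj1_sig q) `<` C} =>
    acc_rank (proj2_sig (proj1_sig p))).

Section ClosedRank.
Context (X : topologicalType).

Lemma ole_crank (C C' : set X) : C `<=` C' -> ole (crank C) (crank C').
Proof.
move=> CC' [q qC]; exists (exist _ q (subset_properl qC CC')).
exact: ole_refl.
Qed.

Lemma crank_ole (C : set X) (cC : closed C)
  (aC : Acc (@closed_lt X) (exist _ C cC)) : ole (crank C) (acc_rank aC).
Proof. by move=> [[A aA] AC]; exact: acc_rank_lt. Qed.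

Lemma olt_crank (C C' : set X) : noetherian X -> closed C -> C `<` C' ->
  olt (crank C) (crank C').
Proof.
move=> noeth cC CC'.
have aC := noetherian_Acc (exist _ C cC) noeth.
exists (exist _ (exist _ (exist _ C cC) aC) CC'); exact: crank_ole.
Qed.

Lemma crankT_stature : noetherian X -> ole (crank [set: X]) (stature X).
Proof.
move=> noeth.
have aT := noetherian_Acc (exist _ _ (@closedT X)) noeth.
apply: ole_trans (crank_ole aT) _.
exact: (@ole_osup _ (osub (subset_rank (@closed X))) (exist _ _ aT)).
Qed.

End ClosedRank.

(** * The weight of a product *)

Lemma odiff_exists a c : exists r, ole a c -> oeq c (oadd a r).
Proof.
have [ac|nac] := pselect (ole a c); last by exists ozero.
by have [r cr] := oadd_subK ac; exists r.
Qed.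

(** Left subtraction c - a, made total by a junk value when a <= c fails. *)
Definition odiff (a c : Ord) : Ord := proj1_sig (cid (odiff_exists a c)).

Lemma odiffK a c : ole a c -> oeq c (oadd a (odiff a c)).
Proof. exact: proj2_sig (cid (odiff_exists a c)). Qed.

Lemma olt_odiff a c c' : ole a c -> olt c c' -> olt (odiff a c) (odiff a c').
Proof.
move=> ac cc'; apply: (@oadd_lt_cancel a).
apply: ole_olt_trans (proj2 (odiffK ac)) _; apply: olt_ole_trans (cc') _.
exact: proj1 (odiffK (ole_trans ac (oltW cc'))).
Qed.

Lemma olt0_odiff a c : olt a c -> olt ozero (odiff a c).
Proof.
move=> ac; apply: (@oadd_lt_cancel a).
apply: (@ole_olt_trans _ a); first exact: ole_trans (oadd_hsum _ _) (hsum0 _).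
exact: olt_ole_trans ac (proj1 (odiffK (oltW ac))).
Qed.

Lemma odiff_triangle a a' c c' : ole a a' -> ole a c -> ole a' c' -> ole c c' ->
  ole (odiff a c) (hsum (odiff a a') (odiff a' c')).
Proof.
move=> aa' ac ac' cc'; apply: ole_trans (oadd_hsum _ _).
apply: (@oadd_cancel a); apply: ole_trans (proj2 (odiffK ac)) _.
apply: ole_trans (cc') _; apply: ole_trans (proj1 (odiffK ac')) _.
apply: ole_trans (proj2 (oaddA _ _ _)).
exact: ole_oadd (proj1 (odiffK aa')) (ole_refl _).
Qed.

Section Weight.
Context (X : topologicalType) (noeth : noetherian X).
Implicit Types (F C : set X) (Cs : seq (set X)).

(** The contribution of a slot C is measured relative to the base F, so that it
    vanishes when C is included in F: weights can then be compared without
    putting products in reduced form. *)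
Definition slot_rank F C : Ord := odiff (crank F) (crank (F `|` C)).

Definition slots_rank F Cs : Ord :=
  foldr (fun C r => hsum (slot_rank F C) r) ozero Cs.

Definition weight F Cs : Ord :=
  hsum (htimes_omega (crank F)) (slots_rank F Cs).

(** One slot C shrinks to C' and loses a point outside F; a point of F would
    not do, because the slot only matters through its union with F. *)
Inductive slot_lt F : seq (set X) -> seq (set X) -> Prop :=
| SlotHere C C' Cs x : C' `<=` C -> C x -> ~ F x -> ~ C' x ->
    slot_lt F (C' :: Cs) (C :: Cs)
| SlotThere C Cs Cs' : slot_lt F Cs' Cs -> slot_lt F (C :: Cs') (C :: Cs).

Lemma weight_slot_lt F Cs Cs' : closed F -> (forall C, C \in Cs' -> closed C) ->
  slot_lt F Cs' Cs -> olt (weight F Cs') (weight F Cs).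
Proof.
move=> cF cCs' lt; apply: olt_hsumr.
elim: lt cCs' => {Cs Cs'}
  [C C' Cs x C'C Cx nFx nC'x|C Cs Cs' _ IH] cl; last first.
  by apply/olt_hsumr/IH => D Din; apply: cl; rewrite in_cons Din orbT.
apply: olt_hsuml; apply: olt_odiff; first exact/ole_crank/subsetUl.
apply: olt_crank => //.
  by apply: closedU => //; apply: cl; rewrite mem_head.
split; first exact: setUS.
by move=> /(_ x (or_intror Cx)) [].
Qed.

(** Each of the subtracted ranks, including those of the k new slots, grows by
    at most c.  These finitely many copies of c, and one more to make the
    inequality strict, are absorbed by the natural product of the larger base
    rank by omega. *)
Lemma weight_base_lt F F' Cs k : closed F' -> F' `<` F ->
  olt (weight F' (Cs ++ nseq k F)) (weight F Cs).
Proof.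
move=> cF' F'F; have F'leF := properW F'F.
pose c := odiff (crank F') (crank F).
have c0 : olt ozero c by exact/olt0_odiff/olt_crank.
have slots : ole (slots_rank F' (Cs ++ nseq k F))
                 (hsum (hmuln c (size Cs + k)) (slots_rank F Cs)).
  elim: Cs => [|C Cs IH].
    apply: ole_trans (ole_hsuml _ _).
    elim: k => [|k IH]; first exact: ole_refl.
    apply: ole_hsum IH; rewrite /slot_rank setUidr //; exact: ole_refl.
  have slotC : ole (slot_rank F' C) (hsum c (slot_rank F C)).
    by apply: odiff_triangle; apply: ole_crank => //;
       exact: setSU.
  apply: ole_trans (ole_hsum slotC IH) _.
  apply: ole_trans (hsumAl _ _ _) _.
  apply: ole_trans (ole_hsum (ole_refl _) (hsumCA _ _ _)) _.
  exact: hsumAr.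
apply: ole_olt_trans (ole_hsum (ole_refl _) slots) _.
apply: ole_olt_trans (hsumAr _ _ _) _.
apply: (@olt_ole_trans _ (hsum (hsum (htimes_omega (crank F'))
                                     (hmuln c (size Cs + k).+1))
                               (slots_rank F Cs))).
  apply/olt_hsuml/olt_hsumr.
  apply: (@ole_olt_trans _ (hsum ozero (hmuln c (size Cs + k)))).
    exact: ole_hsumr.
  exact: olt_hsuml.
apply: ole_hsum (ole_refl _); apply: htimes_omega_add.
by apply: proj2 (odiffK _); exact: ole_crank.
Qed.

End Weight.

(** * Products *)

Section Products.
Context (X : topologicalType).
Implicit Types (F C : set X) (Cs : seq (set X)) (w : seq X) (V : X -> set X).

(** The product F | Cs, pulled back to words because the topology of multisets
    is defined through words. *)
Fixpoint mprod F Cs w : Prop :=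
  if Cs is C :: Cs' then
    mprod F Cs' w \/
    exists x w', [/\ perm_eq w (x :: w'), C x & mprod F Cs' w']
  else forall x, x \in w -> F x.

Lemma perm_swap (x y : X) (s : seq X) :
  perm_eq [:: x, y & s] [:: y, x & s].
Proof. exact/permPl/(perm_catCA [:: x] [:: y]). Qed.

Lemma mprod_perm F Cs w w' : perm_eq w w' -> mprod F Cs w -> mprod F Cs w'.
Proof.
elim: Cs w w' => [|C Cs IH] w w' ww' /=.
  by move=> Fw x xw'; apply: Fw; rewrite (perm_mem ww').
move=> [/(IH _ _ ww') ?|[x [v [wxv Cx vP]]]]; [by left|right].
by exists x, v; split=> //; apply: perm_trans wxv; rewrite perm_sym.
Qed.

Lemma mprod_behead F Cs x w : mprod F Cs (x :: w) -> mprod F Cs w.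
Proof.
elim: Cs w => [|C Cs IH] w /=.
  by move=> Fw y yw; apply: Fw; rewrite in_cons yw orbT.
move=> [/IH ?|[y [v [xwyv Cy vP]]]]; [by left|].
have [xy|xy] := eqVneq x y.
  by left; apply: mprod_perm vP; rewrite perm_sym; rewrite xy perm_cons in xwyv.
have yw : y \in w.
  have : y \in x :: w by rewrite (perm_mem xwyv) mem_head.
  by rewrite in_cons eq_sym (negPf xy).
right; exists y, (rem y w); split=> //; first exact: perm_to_rem.
apply: (IH); apply: mprod_perm vP; rewrite -(perm_cons y) -(permPl xwyv).
by rewrite (permPr (perm_swap y x _)) perm_cons; exact: perm_to_rem.
Qed.

Lemma mprod_cat F Cs w v : mprod F Cs (w ++ v) -> mprod F Cs w.
Proof.
move=> /(@mprod_perm _ _ _ (v ++ w)); rewrite perm_catC => /(_ (perm_refl _)).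
by elim: v => //= x v IH /mprod_behead.
Qed.

Lemma mprod_base F Cs x w : F x -> mprod F Cs w -> mprod F Cs (x :: w).
Proof.
move=> Fx; elim: Cs w => [|C Cs IH] w /=.
  by move=> Fw y; rewrite in_cons => /orP[/eqP ->//|]; exact: Fw.
move=> [/IH ?|[y [v [wyv Cy vP]]]]; [by left|right].
exists y, (x :: v); split=> //; last exact: IH.
by rewrite (permPr (perm_swap y x v)) perm_cons.
Qed.

(** The multiset of w' is obtained from that of w by replacing each x by an
    element of V x and then adding elements.  The pairs in s are the
    replacements; listing them up to permutation makes the notion invariant
    under permutations of both words. *)
Definition embeds V w w' : Prop := exists (s : seq (X * X)) r,
  [/\ perm_eq w (unzip1 s), perm_eq w' (unzip2 s ++ r) &
      forall p, p \in s -> V p.1 p.2].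

Lemma embeds_nil V w : embeds V [::] w.
Proof. by exists [::], w. Qed.

Lemma embeds_cons V x y w w' : V x y -> embeds V w w' ->
  embeds V (x :: w) (y :: w').
Proof.
move=> Vxy [s [r [ws w's Vs]]]; exists ((x, y) :: s), r.
rewrite /= !perm_cons; split=> // p; rewrite in_cons => /orP[/eqP ->//|].
exact: Vs.
Qed.

Lemma embeds_weaken V y w w' : embeds V w w' -> embeds V w (y :: w').
Proof.
move=> [s [r [ws w's Vs]]]; exists s, (y :: r); split=> //.
by rewrite perm_sym (perm_catCA (unzip2 s) [:: y] r) /= perm_cons perm_sym.
Qed.

Lemma embeds_perm V w v w' v' : perm_eq w v -> perm_eq w' v' ->
  embeds V w w' -> embeds V v v'.
Proof.
move=> wv w'v' [s [r [ws w's Vs]]]; exists s, r; split=> //.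
  by rewrite -(permPl wv).
by rewrite -(permPl w'v').
Qed.

(** Membership in a product depends only on which of the sets F and Cs each
    letter belongs to, and a product is closed under removal of letters. *)
Lemma embeds_mprod V F Cs w w' :
  (forall x y G, G \in F :: Cs -> V x y -> G y -> G x) ->
  embeds V w w' -> mprod F Cs w' -> mprod F Cs w.
Proof.
move=> Vclosed [s [r [ws w's Vs]]] /(mprod_perm w's) /mprod_cat sP.
apply: (@mprod_perm _ _ (unzip1 s)); first by rewrite perm_sym.
elim: Cs s Vclosed Vs {ws w's} sP => [|C Cs IH] s Vclosed Vs /=.
  move=> Fs x /mapP [p ps ->]; apply: (Vclosed p.1 p.2); first exact: mem_head.
    exact: Vs.
  by apply: Fs; apply/mapP; exists p.
have Vclosed' x y G : G \in F :: Cs -> V x y -> G y -> G x.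
  move=> GF; apply: Vclosed; move: GF; rewrite !in_cons.
  by move=> /orP[->|->]; rewrite ?orbT.
move=> [/(IH _ Vclosed' Vs) ?|[y [v [syv Cy vP]]]]; [by left|right].
have /mapP [p ps yE] : y \in unzip2 s by rewrite (perm_mem syv) mem_head.
exists p.1, (unzip1 (rem p s)); split.
- exact: (perm_map fst (perm_to_rem ps)).
- apply: (Vclosed p.1 p.2); last by rewrite -yE.
    by rewrite !in_cons eqxx orbT.
  exact: Vs.
- apply: (IH _ Vclosed'); first by move=> q /mem_rem; exact: Vs.
  apply: mprod_perm vP; rewrite -(perm_cons y) -(permPl syv) yE.
  exact: (perm_map snd (perm_to_rem ps)).
Qed.

(** The two ways to shrink a product.  The new slots are put at the end so that
    prefixing a slot preserves the relation. *)
Definition smaller F Cs (Q : set X * seq (set X)) : Prop :=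
  (Q.1 = F /\ slot_lt F Q.2 Cs) \/
  (Q.1 `<` F /\ exists k, Q.2 = Cs ++ nseq k F).

Lemma smaller_cons F Cs C Q : smaller F Cs Q ->
  smaller F (C :: Cs) (Q.1, C :: Q.2).
Proof.
move=> [[QF lt]|[QF [k QE]]]; [left|right]; split=> //; first exact: SlotThere.
by exists k; rewrite /= QE.
Qed.

(** For a product without slots, look greedily in w' for elements of the V x,
    with x running through w.  If the search stops at x after k successes,
    the letters of w' that are not yet used avoid V x, and the used ones fill
    k slots F. *)
Lemma mprod_shrink_base F V w : (forall x, V x x) -> mprod F [::] w ->
  exists Qs : seq (set X * seq (set X)),
    (forall Q, Q \in Qs -> exists x k, F x /\ Q = (F `\` V x, nseq k F)) /\
    forall w', mprod F [::] w' ->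
      embeds V w w' \/ exists2 Q, Q \in Qs & mprod Q.1 Q.2 w'.
Proof.
move=> Vxx; elim: w => [|x w IH] Fw.
  by exists [::]; split=> // w' _; left; exact: embeds_nil.
have [Qs [Qsmall Qcover]] := IH (mprod_behead Fw).
have Fx : F x by apply: Fw; exact: mem_head.
exists ((F `\` V x, [::]) :: map (fun Q => (Q.1, F :: Q.2)) Qs); split.
  move=> Q; rewrite in_cons => /orP[/eqP ->|/mapP[R RQs ->]].
    by exists x, 0%N.
  by have [y [k [Fy ->]]] := Qsmall R RQs; exists y, k.+1.
move=> w' Fw'.
have [[y yw' Vxy]|noV] := pselect (exists2 y, y \in w' & V x y); last first.
  right; exists (F `\` V x, [::]); first exact: mem_head.
  move=> y yw'; split; first exact: Fw'.
  by move=> Vxy; apply: noV; exists y.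
have w'y := perm_to_rem yw'.
have [emb|[R RQs Rw']] := Qcover (rem y w') (mprod_behead (mprod_perm w'y Fw')).
  left; apply: (embeds_perm (perm_refl _) _ (embeds_cons Vxy emb)).
  by rewrite perm_sym.
right; exists (R.1, F :: R.2).
  by rewrite in_cons; apply/orP; right; apply/mapP; exists R.
by right; exists y, (rem y w'); split=> //; exact: Fw'.
Qed.

Lemma smaller_map F C Cs (Qs : seq (set X * seq (set X))) : closed C ->
  (forall Q, Q \in Qs -> smaller F Cs Q /\
                         forall D, D \in Q.1 :: Q.2 -> closed D) ->
  forall Q, Q \in map (fun Q => (Q.1, C :: Q.2)) Qs ->
    smaller F (C :: Cs) Q /\ forall D, D \in Q.1 :: Q.2 -> closed D.
Proof.
move=> cC Qsmall Q /mapP [R RQs ->]; have [Rs cR] := Qsmall R RQs.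
split=> [|D]; first exact: smaller_cons.
rewrite !in_cons orbCA => /orP[/eqP ->//|]; rewrite -in_cons; exact: cR.
Qed.

(** By induction on the slots.  If a letter x of w outside F occupies the slot
    C, either w' has no letter of V x in this slot, and C can be replaced by
    C \ V x, or a letter of w' in the slot matches x and the induction
    hypothesis deals with the other letters.  If w does not need the slot C,
    the induction hypothesis applies to w' without its letter in C: this letter
    then counts as an added one, or keeps its slot in a smaller product. *)
Lemma mprod_shrink F Cs V w : (forall x, V x x) -> (forall x, open (V x)) ->
  closed F -> (forall C, C \in Cs -> closed C) -> mprod F Cs w ->
  exists Qs : seq (set X * seq (set X)),
    (forall Q, Q \in Qs -> smaller F Cs Q /\
                           forall C, C \in Q.1 :: Q.2 -> closed C) /\
    forall w', mprod F Cs w' ->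
      embeds V w w' \/ exists2 Q, Q \in Qs & mprod Q.1 Q.2 w'.
Proof.
move=> Vxx Vo cF.
have cD C x : closed C -> closed (C `\` V x).
  by move=> cC; rewrite setDE; apply: closedI => //; exact: open_closedC.
elim: Cs w => [|C Cs IH] w cCs.
  move=> Fw; have [Qs [Qsmall Qcover]] := mprod_shrink_base Vxx Fw.
  exists Qs; split=> // Q /Qsmall [x [k [Fx ->]]]; split.
    right; split; last by exists k.
    by split=> [|/(_ x Fx) [_]]; [exact: subDsetl|apply].
  move=> D; rewrite in_cons => /orP[/eqP ->|/nseqP [-> _]//]; exact: cD.
have cC : closed C by apply: cCs; exact: mem_head.
have cCs' D : D \in Cs -> closed D.
  by move=> DCs; apply: cCs; rewrite in_cons DCs orbT.
have [wP _|nwP] := pselect (mprod F Cs w).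
  have [Qs [Qsmall Qcover]] := IH w cCs' wP.
  exists (map (fun Q => (Q.1, C :: Q.2)) Qs); split; first exact: smaller_map.
  have lift w' Q : Q \in Qs -> mprod Q.1 (C :: Q.2) w' ->
      exists2 Q, Q \in map (fun Q => (Q.1, C :: Q.2)) Qs & mprod Q.1 Q.2 w'.
    by move=> QQs w'Q; exists (Q.1, C :: Q.2) => //; apply/mapP; exists Q.
  move=> w' [/Qcover [|[Q QQs w'Q]]|]; first by left.
    by right; apply: (lift _ _ QQs); left.
  move=> [y [v [w'yv Cy /Qcover [emb|[Q QQs vQ]]]]].
    left; apply: (embeds_perm (perm_refl w) _ (embeds_weaken y emb)).
    by rewrite perm_sym.
  by right; apply: (lift _ _ QQs); right; exists y, v.
move=> [//|[x [u [wxu Cx uP]]]].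
(* otherwise x could be moved to the base, and w would not need the slot C *)
have nFx : ~ F x.
  move=> Fx; apply: nwP; apply: (@mprod_perm _ _ (x :: u)).
    by rewrite perm_sym.
  exact: mprod_base.
have [Qs [Qsmall Qcover]] := IH u cCs' uP.
exists ((F, (C `\` V x) :: Cs) :: map (fun Q => (Q.1, C :: Q.2)) Qs); split.
  move=> Q; rewrite in_cons => /orP[/eqP ->|]; last exact: smaller_map.
  split=> [|D].
    left; split=> //.
    by apply: SlotHere Cx nFx _ => [|[_]]; [exact: subDsetl|apply].
  by rewrite !in_cons => /or3P[/eqP ->//|/eqP ->|/cCs'//]; exact: cD.
have skip w' : mprod F ((C `\` V x) :: Cs) w' ->
    exists2 Q, Q \in (F, (C `\` V x) :: Cs) ::
                     map (fun Q => (Q.1, C :: Q.2)) Qs & mprod Q.1 Q.2 w'.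
  by move=> w'P; exists (F, (C `\` V x) :: Cs) => //; exact: mem_head.
move=> w' [w'P|[y [v [w'yv Cy vP]]]]; first by right; apply: skip; left.
have [Vxy|nVxy] := pselect (V x y); last first.
  by right; apply: skip; right; exists y, v.
have [emb|[Q QQs vQ]] := Qcover v vP.
  left; apply: (embeds_perm _ _ (embeds_cons Vxy emb)); by rewrite perm_sym.
right; exists (Q.1, C :: Q.2).
  by rewrite in_cons; apply/orP; right; apply/mapP; exists Q.
by right; exists y, v.
Qed.

End Products.

Lemma mem_cons_tail (T : eqType) (x y : T) s : y \in s -> y \in x :: s.
Proof. exact: (@mem_behead _ (x :: s)). Qed.

(** * Neighbourhoods of words and of multisets *)

Section Words.
Context (X : topologicalType).
Implicit Types (w : seq X) (V : X -> set X).

Lemma word_subbasic_open (Us : seq (set X)) : (forall U, U \in Us -> open U) ->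
  open (word_subbasic Us : set (words X)).
Proof.
move=> Uso; exists [set word_subbasic Us]; last by rewrite bigcup_set1.
move=> _ ->; exists [fset word_subbasic Us]%fset.
  by move=> W /fset1P ->; apply/mem_set; exists Us.
apply/seteqP; split=> w; first by apply; apply/fset1P.
by move=> wU W /fset1P ->.
Qed.

Lemma word_subbasic_self V w : (forall x, V x x) ->
  word_subbasic (map V w) w.
Proof.
move=> Vxx; elim: w => //= x w IH; exists [::], (x :: w); split=> //.
by exists [:: x], w; split=> //; exists x.
Qed.

Lemma word_subbasic_embeds V w w' : word_subbasic (map V w) w' ->
  embeds V w w'.
Proof.
elim: w w' => [|x w IH] w'; first by move=> _; exact: embeds_nil.
move=> [u [_ [_ [_ [v [[y Vxy ->] /IH emb ->]]] ->]]] /=.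
elim: u => [|z u IHu]; first exact: embeds_cons.
exact: embeds_weaken.
Qed.

Lemma embeds_word_subbasic V w w' : embeds V w w' ->
  exists2 v, perm_eq w' v & word_subbasic (map V w) v.
Proof.
elim: w w' => [|x w IH] w'; first by exists w'.
move=> [s [r [ws w's Vs]]].
have /mapP [p ps xE] : x \in unzip1 s by rewrite -(perm_mem ws) mem_head.
have sp := perm_to_rem ps.
have [|v vP vV] := IH (unzip2 (rem p s) ++ r).
  exists (rem p s), r; split=> // [|q /mem_rem]; last exact: Vs.
  rewrite -(perm_cons x) (permPl ws) xE; exact: (perm_map fst sp).
exists (p.2 :: v).
  apply: (perm_trans w's).
  apply: (@perm_trans _ (p.2 :: unzip2 (rem p s) ++ r)).
    rewrite -cat_cons perm_cat2r; exact: (perm_map snd sp).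
  by rewrite perm_cons.
exists [::], (p.2 :: v); split=> //; exists [:: p.2], v; split=> //.
by exists p.2 => //; rewrite xE; exact: Vs.
Qed.

Lemma word_subbasic_cat (Us : seq (set X)) u v :
  word_subbasic Us v -> word_subbasic Us (u ++ v).
Proof.
case: Us => // U Us [v1 [v2 [_ v2P ->]]].
by exists (u ++ v1), v2; rewrite catA.
Qed.

(** It is enough to compare letter by letter: if a letter of w lies in some U,
    all letters allowed in its place by V do as well. *)
Lemma word_subbasic_pointwise (Us : seq (set X)) V w :
  (forall U x, U \in Us -> U x -> V x `<=` U) ->
  word_subbasic Us w -> word_subbasic (map V w) `<=` word_subbasic Us.
Proof.
elim: Us w => [|U Us IH] w VU //.
move=> [u [_ [_ [_ [v [[x Ux ->] vP ->]]] ->]]] w'.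
elim: u w' => [|z u IHu] w'; last first.
  move=> [u1 [_ [_ [y [v1 [_ /IHu v1P ->]]] ->]]].
  by do 2!apply: word_subbasic_cat.
move=> [u1 [_ [_ [_ [v1 [[y Vy ->] v1P ->]]] ->]]].
exists u1, ([:: y] ++ v1); split=> //; exists [:: y], v1; split=> //.
  by exists y => //; apply: VU Vy; rewrite ?mem_head.
by apply: IH v1P => // U' x' U'Us; apply: VU; rewrite in_cons U'Us orbT.
Qed.

Lemma open_bigcap_seq (s : seq (set X)) (P : set X -> Prop) :
  (forall U, U \in s -> P U -> open U) ->
  open (\bigcap_(U in [set U | U \in s /\ P U]) U).
Proof.
elim: s => [|U s IH] so.
  rewrite (_ : bigcap _ _ = setT); first exact: openT.
  by apply/seteqP; split=> // x _ U [].
have {}IH := IH (fun U' U's => so U' (mem_cons_tail _ U's)).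
have [PU|nPU] := pselect (P U).
  rewrite (_ : bigcap _ _ = U `&` \bigcap_(U in [set U | U \in s /\ P U]) U).
    by apply: openI => //; apply: so => //; exact: mem_head.
  apply/seteqP; split=> x.
    move=> xU; split=> [|W [Ws PW]]; apply: xU; split=> //.
      exact: mem_head.
    exact: mem_cons_tail.
  by move=> [Ux xs] W [/[1!in_cons] /orP[/eqP ->//|Ws] PW]; exact: xs.
rewrite (_ : bigcap _ _ = \bigcap_(U in [set U | U \in s /\ P U]) U) //.
apply/seteqP; split=> x xU W [Ws PW]; apply: xU; split=> //.
  exact: mem_cons_tail.
by move: Ws; rewrite in_cons => /orP[/eqP WU|//]; rewrite WU in PW.
Qed.

(** Basic open sets are finite intersections of subbasic ones.  Take for V x the
    intersection of the finitely many open sets that contain x among those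
    that occur in the description of a basic neighbourhood of w. *)
Lemma word_nbhd (A : set (words X)) w : open A -> A w ->
  exists V, [/\ forall x, open (V x), forall x, V x x &
    word_subbasic (map V w) `<=` A].
Proof.
move=> [B BfinI <-] [W0 BW0 W0w]; have [D Dsub W0E] := BfinI W0 BW0.
change (W0 w) in W0w.
have letters W : {Us : seq (set X) | W \in D ->
    (forall U, U \in Us -> open U) /\ W = word_subbasic Us}.
  apply: cid; have [WD|] := boolP (W \in D); last by exists [::].
  by have /set_mem [Us Uso WE] := Dsub _ WD; exists Us.
pose Us W := proj1_sig (letters W).
have UsP W : W \in D ->
    (forall U, U \in Us W -> open U) /\ W = word_subbasic (Us W).
  exact: proj2_sig (letters W).
pose L := flatten (map Us D).
exists (fun x => \bigcap_(U in [set U | U \in L /\ U x]) U); split.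
- move=> x; apply: open_bigcap_seq => U /flattenP [_ /mapP [W WD ->] UW] _.
  by have [Uo _] := UsP W WD; exact: Uo.
- by move=> x U [].
- move=> w' w'V; exists W0; first exact: BW0.
  change (W0 w'); rewrite -W0E => W WD; change (W w').
  have [Uo WE] := UsP W WD; rewrite WE.
  apply: word_subbasic_pointwise w'V; last first.
    by rewrite -WE; move: W0w; rewrite -W0E; apply.
  move=> U x UW Ux y; apply; split=> //; apply/flattenP; exists (Us W) => //.
  exact: map_f.
Qed.

(** If w is not in the product, let V x be the intersection of the complements
    of the sets F and C, for C in Cs, that do not contain x: by
    [embeds_mprod], the corresponding neighbourhood of w avoids the product. *)
Lemma mprod_word_closed F Cs : closed F -> (forall C, C \in Cs -> closed C) ->
  closed (mprod F Cs : set (words X)).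
Proof.
move=> cF cCs; rewrite -openC openE => w nPw.
pose V x := \bigcap_(U in [set U | U \in map (@setC X) (F :: Cs) /\ U x]) U.
have Vo x : open (V x).
  apply: open_bigcap_seq => U /mapP [C CF ->] _; apply: closed_openC.
  by move: CF; rewrite in_cons => /orP[/eqP ->//|]; exact: cCs.
apply: (@filterS _ _ _ (word_subbasic (map V w))); last first.
  apply: open_nbhs_nbhs; split; last by apply: word_subbasic_self => x U [].
  by apply: word_subbasic_open => U /mapP [x _ ->].
move=> w' /word_subbasic_embeds emb w'P; apply: nPw.
apply: embeds_mprod emb w'P => x y G GF Vxy Gy; apply: contrapT => nGx.
by apply: (Vxy (~` G)) Gy; split=> //; exact: map_f.
Qed.

Definition mset_mprod F Cs : set (msets X) :=
  [set m | mprod F Cs (enum_mset (m : mset_carrier X))].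

Lemma mset_mprod_parikh F Cs w : mset_mprod F Cs (parikh w) <-> mprod F Cs w.
Proof.
by split; apply: mprod_perm; rewrite ?perm_eq_seq_mset //
  perm_sym perm_eq_seq_mset.
Qed.

Lemma mset_mprod_closed F Cs : closed F -> (forall C, C \in Cs -> closed C) ->
  closed (mset_mprod F Cs).
Proof.
move=> cF cCs; rewrite -openC msets_openE.
rewrite (_ : _ @^-1` _ = ~` (mprod F Cs : set (words X))).
  exact/closed_openC/mprod_word_closed.
by apply/seteqP; split=> w; apply: contra_not => /mset_mprod_parikh.
Qed.

(** The preimage of D among words is invariant under permutations, so the order
    imposed on letters by a neighbourhood of words can be forgotten. *)
Lemma mset_nbhd (D : set (msets X)) (m : msets X) : closed D -> ~ D m ->
  exists V, [/\ forall x, open (V x), forall x, V x x &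
    forall w, embeds V (enum_mset (m : mset_carrier X)) w -> ~ D (parikh w)].
Proof.
move=> /closed_openC; rewrite msets_openE => Do nDm.
have [|V [Vo Vxx VD]] := @word_nbhd _ (enum_mset (m : mset_carrier X)) Do.
  by rewrite /= (parikhK (m : mset_carrier X)).
exists V; split=> // w /embeds_word_subbasic [v /eq_seq_msetP wv /VD].
by rewrite /parikh wv.
Qed.

(** * Shrinking a product around an irreducible closed set *)

Lemma irreducible_cover (Y : topologicalType) (T : eqType) (D : set Y)
  (G : T -> set Y) (s : seq T) : irreducible_closed D ->
  (forall t, t \in s -> closed (G t)) ->
  (forall y, D y -> exists2 t, t \in s & G t y) ->
  exists2 t, t \in s & D `<=` G t.
Proof.
move=> [_ [y Dy] Dirr]; elim: s => [|t s IH] Gcl DG.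
  by have [] := DG y Dy.
have clU : closed [set y | exists2 t, t \in s & G t y].
  elim: s {IH DG} Gcl => [|t' s IH] Gcl.
    rewrite (_ : mkset _ = set0); first exact: closed0.
    by apply/seteqP; split=> z // [? //].
  rewrite (_ : mkset _ = G t' `|` [set y | exists2 t, t \in s & G t y]).
    apply: closedU; first by apply: Gcl; rewrite !in_cons eqxx orbT.
    apply: IH => r; rewrite in_cons => /orP[/eqP ->|rs]; apply: Gcl.
      exact: mem_head.
    by rewrite !in_cons rs !orbT.
  apply/seteqP; split=> z.
    by move=> [r]; rewrite in_cons => /orP[/eqP ->|rs] Gz;
       [left|right; exists r].
  move=> [Gz|[r rs Gz]]; first by exists t' => //; exact: mem_head.
  by exists r => //; exact: mem_cons_tail.
have [||Dt|/IH [|r rs Dr]] := Dirr (G t) _ _ clU.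
- exact/Gcl/mem_head.
- move=> z /DG [r]; rewrite in_cons => /orP[/eqP ->|rs] Gz; first by left.
  by right; exists r.
- by exists t => //; exact: mem_head.
- by move=> r rs; apply: Gcl; exact: mem_cons_tail.
- by exists r => //; exact: mem_cons_tail.
Qed.

(** The point m of the product provides, through a neighbourhood that avoids D,
    finitely many smaller products that cover D. *)
Lemma irreducible_shrink (D : set (msets X)) F Cs m : noetherian X ->
  irreducible_closed D -> closed F -> (forall C, C \in Cs -> closed C) ->
  D `<=` mset_mprod F Cs -> mset_mprod F Cs m -> ~ D m ->
  exists F' Cs', [/\ forall C, C \in F' :: Cs' -> closed C,
    D `<=` mset_mprod F' Cs' & olt (weight F' Cs') (weight F Cs)].
Proof.
move=> noeth Dirr cF cCs DP Pm nDm; have [Dcl _ _] := Dirr.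
have [V [Vo Vxx VD]] := mset_nbhd Dcl nDm.
have [Qs [Qsmall Qcover]] := mprod_shrink Vxx Vo cF cCs Pm.
have [|m' Dm'|[F' Cs'] QQs DQ] :=
  @irreducible_cover _ _ D (fun Q => mset_mprod Q.1 Q.2) Qs Dirr.
- move=> Q /Qsmall [_ cQ]; apply: mset_mprod_closed => [|C CQ]; apply: cQ.
    exact: mem_head.
  exact: mem_cons_tail.
- have [/VD|[Q QQs m'Q]] := Qcover _ (DP _ Dm'); last by exists Q.
  by rewrite (parikhK (m' : mset_carrier X)).
have [lt cQ] := Qsmall _ QQs; exists F', Cs'; split=> //.
case: lt => /= [[F'F lt]|[F'F [k ->]]].
  rewrite F'F; apply: weight_slot_lt => // C CCs'.
  by apply: cQ; exact: mem_cons_tail.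
by apply: weight_base_lt => //; apply: cQ; exact: mem_head.
Qed.

(** If E is strictly included in D, the product around D contains a point that
    E misses, and hence can be shrunk around E. *)
Lemma acc_rank_weight (D : {D : set (msets X) | irreducible_closed D})
  (aD : Acc (fun A B => proj1_sig A `<` proj1_sig B) D) F Cs :
  noetherian X -> closed F -> (forall C, C \in Cs -> closed C) ->
  proj1_sig D `<=` mset_mprod F Cs -> ole (acc_rank aD) (weight F Cs).
Proof.
move=> noeth; have := aD; move=> accD; move: accD aD F Cs.
elim=> {}D _ IH aD F Cs cF cCs DP.
apply: acc_rank_ole => E aE [ED nDE].
have [m [Dm nEm]] : exists m, proj1_sig D m /\ ~ proj1_sig E m.
  by move: nDE => /existsNP [m /not_implyP]; exists m.
have [F' [Cs' [cF' EP lt]]] := irreducible_shrink noeth (proj2_sig E) cF cCs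
  (subset_trans ED DP) (DP _ Dm) nEm.
apply: ole_olt_trans lt; apply: IH => //; first by apply: cF'; exact: mem_head.
by move=> C CCs'; apply: cF'; exact: mem_cons_tail.
Qed.

End Words.

Theorem proposition14p8 (X : topologicalType) :
  noetherian X ->
  ole (sob (msets X)) (osucc (nmul (stature X) oomega)) /\
  ole (rsob (msets X)) (nmul (stature X) oomega).
Proof.
move=> noeth.
have rank_le i : ole (osub (sob (msets X)) i) (nmul (stature X) oomega).
  case: i => D aD /=; apply: (@ole_trans _ (weight [set: X] [::])).
    by apply: acc_rank_weight => //; exact: closedT.
  apply: ole_trans (htimes_omega_nmul _); apply: ole_trans (hsum0 _) _.
  apply: ole_trans (ole_hsuml _ (hmuln ozero 0)) (htimes_omega_add _ _).
  apply: ole_trans (oadd_hsum _ _) _; apply: ole_trans (hsum0 _) _.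
  exact: crankT_stature.
split; last exact: osup_ole.
by move=> i; exists tt; exact: rank_le.
Qed.
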